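(* Let $\{(\mathbf X_i,\mathbf Y_i,\mathbf Z_i)\}_{1\le i\le n}$ be i.i.d. observations from a $d$-dimensional distribution $\mathrm P$, where the dimension $d=d(n)$ (and hence $\mathrm P$) is allowed to grow with the sample size $n$. If $n\,\zeta_\sigma(\mathrm P)\to\infty$ as $n\to\infty$, then for any level $\alpha\in(0,1)$ the power of the proposed test converges to one as $n,d\to\infty$.
   Context: Fix $\sigma^2>0$, $K(\mathbf x,\mathbf y)=\exp\{-\sigma^2\|\mathbf x-\mathbf y\|^2/2\}$. The conditional distribution $\mathrm P_{\mathbf X\mid\mathbf Z}$ is known; given the sample, the $\mathbf X_i'$ are drawn independently with $\mathbf X_i'\sim\mathrm P_{\mathbf X\mid\mathbf Z_i}$ (so $\mathbf X_i'$ is conditionally independent of $(\mathbf X_i,\mathbf Y_i)$ given $\mathbf Z_i$). With $\mathbf V_i=(\mathbf X_i,\mathbf Y_i,\mathbf Z_i)$ and $\mathbf V_i'=(\mathbf X_i',\mathbf Y_i,\mathbf Z_i)$, $\zeta_\sigma(\mathrm P)=\mathbb E[K(\mathbf V_1,\mathbf V_2)]+\mathbb E[K(\mathbf V_1',\mathbf V_2')]-2\mathbb E[K(\mathbf V_1,\mathbf V_2')]$ and $$\hat\zeta_{n,\sigma}=\binom n2^{-1}\sum_{1\le i<j\le n}\big\{K(\mathbf V_i,\mathbf V_j)+K(\mathbf V_i',\mathbf V_j')-K(\mathbf V_i,\mathbf V_j')-K(\mathbf V_i',\mathbf V_j)\big\}.$$ For $\pi\in\{0,1\}^n$, $\hat\zeta_{n,\sigma}(\pi)$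 is the same statistic with $(\mathbf X_i,\mathbf X_i')$ replaced by $(\mathbf U_i,\mathbf U_i')$, $\mathbf U_i=\pi(i)\mathbf X_i+(1-\pi(i))\mathbf X_i'$, $\mathbf U_i'=(1-\pi(i))\mathbf X_i+\pi(i)\mathbf X_i'$, and $\hat c_{1-\alpha}=\inf\{t\in\mathbb R:2^{-n}\sum_{\pi\in\{0,1\}^n}\mathrm I[\hat\zeta_{n,\sigma}(\pi)\le t]\ge1-\alpha\}$. The proposed test rejects when $\hat\zeta_{n,\sigma}>\hat c_{1-\alpha}$. *)

(* Defs.v *)
From HB Require Import structures.
From mathcomp Require Import all_boot all_order all_algebra.
From mathcomp Require Import all_classical all_reals all_analysis.
From mathcomp Require Import measurable_realfun.

Set Implicit Arguments.
Unset Strict Implicit.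
Unset Printing Implicit Defensive.

Import Order.TTheory GRing.Theory Num.Theory.
Import numFieldNormedType.Exports.

Local Open Scope classical_set_scope.
Local Open Scope ring_scope.

(* A point (x, y, z) of R^dx * R^dy * R^dz, encoded as ((x, y), z).  The
   library's sigma-algebra on [d.-tuple R] is the product of the Borel
   sigma-algebras, i.e. the Borel sigma-algebra of R^d. *)
Notation obs R dx dy dz := (dx.-tuple R * dy.-tuple R * dz.-tuple R)%type.

Section statistic.
Context {R : realType}.

Definition sqdist {d : nat} (u v : d.-tuple R) : R :=
  \sum_(k < d) (tnth u k - tnth v k) ^+ 2.

Definition gaussK (sigma : R) {d : nat} (u v : d.-tuple R) : R :=
  expR (- (sigma ^+ 2 * sqdist u v / 2)).

Context {dx dy dz : nat}.

Definition vec (v : obs R dx dy dz) : (dx + dy + dz).-tuple R :=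
  cat_tuple (cat_tuple v.1.1 v.1.2) v.2.

Definition replX (v : obs R dx dy dz) (x' : dx.-tuple R) : obs R dx dy dz :=
  (x', v.1.2, v.2).

Definition Kobs (sigma : R) (v w : obs R dx dy dz) : R :=
  gaussK sigma (vec v) (vec w).

Definition zeta_hat (sigma : R) (n : nat)
    (V V' : 'I_n -> obs R dx dy dz) : R :=
  ('C(n, 2)%:R)^-1 *
  \sum_(i < n) \sum_(j < n | (i < j)%N)
    (Kobs sigma (V i) (V j) + Kobs sigma (V' i) (V' j)
     - Kobs sigma (V i) (V' j) - Kobs sigma (V' i) (V j)).

(* The two arguments are the sample and the resampled x-components. *)
Definition stat (sigma : R) (n : nat)
    (V : 'I_n -> obs R dx dy dz) (X' : 'I_n -> dx.-tuple R) : R :=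
  zeta_hat sigma V (fun i => replX (V i) (X' i)).

Definition stat_swap (sigma : R) (n : nat)
    (V : 'I_n -> obs R dx dy dz) (X' : 'I_n -> dx.-tuple R)
    (p : {ffun 'I_n -> bool}) : R :=
  let U i := if p i then (V i).1.1 else X' i in
  let U' i := if p i then X' i else (V i).1.1 in
  stat sigma (fun i => replX (V i) (U i)) U'.

Definition crit (sigma alpha : R) (n : nat)
    (V : 'I_n -> obs R dx dy dz) (X' : 'I_n -> dx.-tuple R) : R :=
  inf [set t : R | 1 - alpha <=
    (2 ^+ n)^-1 * \sum_(p : {ffun 'I_n -> bool})
                     (stat_swap sigma V X' p <= t)%R%:R].

End statistic.

Section resampling_law.
Context {R : realType} {dx dy dz : nat}.
Variables (P : probability (obs R dx dy dz) R)
  (kappa : R.-pker (dz.-tuple R) ~> (dx.-tuple R)).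

(* kappa is a regular version of the conditional law of X given Z under P. *)
Definition is_cond_law : Prop :=
  forall (A : set (dx.-tuple R)) (C : set (dz.-tuple R)),
    measurable A -> measurable C ->
    P [set v | A v.1.1 /\ C v.2] =
    (\int[P]_(v in [set v | C v.2]) kappa v.2 A)%E.

Definition kappa_obs (v : obs R dx dy dz) :
  {measure set (dx.-tuple R) -> \bar R} := kappa v.2.

Let measurable_kappa_obs U : measurable U ->
  measurable_fun setT (kappa_obs ^~ U).
Proof.
move=> mU; rewrite [X in measurable_fun _ X](_ : _ = (kappa ^~ U) \o snd)//.
by apply: measurableT_comp => //; exact: measurable_kernel.
Qed.

HB.instance Definition _ :=
  isKernel.Build _ _ _ _ R kappa_obs measurable_kappa_obs.

Let kappa_obs_prob v : kappa_obs v setT = 1%E.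
Proof. exact: prob_kernel. Qed.

HB.instance Definition _ :=
  Kernel_isProbability.Build _ _ _ _ R kappa_obs kappa_obs_prob.

(* Law of (V, X'), where V = (X, Y, Z) has law P and the conditional law of X'
   given V is kappa(Z). *)
Definition joint_law (A : set (obs R dx dy dz * dx.-tuple R)) : \bar R :=
  (\int[P]_v kappa v.2 (xsection A v))%E.

Let joint_law0 : joint_law set0 = 0%E.
Proof. by apply: integral0_eq => v _; rewrite xsection0 measure0. Qed.

Let joint_law_ge0 A : (0 <= joint_law A)%E.
Proof. by apply: integral_ge0 => v _; exact: measure_ge0. Qed.

Let joint_law_sigma_additive : semi_sigma_additive joint_law.
Proof.
move=> F mF tF mUF.
have -> : joint_law (\bigcup_n F n) = (\sum_(n <oo) joint_law (F n))%E.
  transitivity (\int[P]_v \sum_(n <oo) kappa v.2 (xsection (F n) v))%E.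
    apply: eq_integral => v _; rewrite xsection_bigcup.
    apply/esym/cvg_lim => //.
    apply: measure_sigma_additive; last exact: trivIset_xsection.
    by move=> n; exact: measurable_xsection.
  rewrite integral_nneseries// => n.
  exact: (measurable_fun_xsection_finite_kernel kappa_obs (mem_set (mF n))).
by apply: is_cvg_nneseries => n _ _; exact: joint_law_ge0.
Qed.

HB.instance Definition _ := isMeasure.Build _ _ R joint_law
  joint_law0 joint_law_ge0 joint_law_sigma_additive.

Let joint_law_setT : joint_law setT = 1%E.
Proof.
rewrite /joint_law (eq_integral (fun=> 1%E)); last first.
  by move=> v _; rewrite xsectionE preimage_setT prob_kernel.
by rewrite integral_cst// mul1e; exact: probability_setT.
Qed.

HB.instance Definition _ :=
  Measure_isProbability.Build _ _ R joint_law joint_law_setT.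

(* Expectations over two independent copies (V_1, X'_1), (V_2, X'_2) with law
   joint_law; they are finite because 0 <= K <= 1. *)
Definition zeta (sigma : R) : R :=
  let V (w : obs R dx dy dz * dx.-tuple R) := w.1 in
  let V' (w : obs R dx dy dz * dx.-tuple R) := replX w.1 w.2 in
  fine ('E_(joint_law \x joint_law)[fun w => Kobs sigma (V w.1) (V w.2)]
      + 'E_(joint_law \x joint_law)[fun w => Kobs sigma (V' w.1) (V' w.2)]
      - 2%:E * 'E_(joint_law \x joint_law)[fun w =>
                                             Kobs sigma (V w.1) (V' w.2)])%E.

End resampling_law.

Section sampling.
Context {R : realType} {dx dy dz : nat} {dT : measure_display}
  {T : measurableType dT} {Pr : probability T R} {n : nat}.

Definition iid_sample (P : probability (obs R dx dy dz) R)
    (V : 'I_n -> {RV Pr >-> obs R dx dy dz}) : Prop :=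
  (forall i A, measurable A -> Pr (V i @^-1` A) = P A) /\
  (forall A : 'I_n -> set (obs R dx dy dz), (forall i, measurable (A i)) ->
    Pr [set w | forall i, A i (V i w)] =
    (\prod_(i < n) Pr (V i @^-1` A i))%E).

(* The conditional law of (X'_1, ..., X'_n) given the sample (V_1, ..., V_n) is
   the product of the laws kappa(Z_i): the defining identity is tested on every
   event of the sigma-algebra of the sample. *)
Definition resampled (kappa : R.-pker (dz.-tuple R) ~> (dx.-tuple R))
    (V : 'I_n -> {RV Pr >-> obs R dx dy dz})
    (X' : 'I_n -> {RV Pr >-> dx.-tuple R}) : Prop :=
  forall (A : set (n.-tuple (obs R dx dy dz))) (B : 'I_n -> set (dx.-tuple R)),
    measurable A -> (forall i, measurable (B i)) ->
    Pr [set w | A [tuple V i w | i < n] /\ forall i, B i (X' i w)] =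
    (\int[Pr]_(w in [set w | A [tuple V i w | i < n]])
       \prod_(i < n) kappa (V i w).2 (B i))%E.

Definition test_power (sigma alpha : R) (V : 'I_n -> {RV Pr >-> obs R dx dy dz})
    (X' : 'I_n -> {RV Pr >-> dx.-tuple R}) : \bar R :=
  Pr [set w | crit sigma alpha (fun i => V i w) (fun i => X' i w) <
              stat sigma (fun i => V i w) (fun i => X' i w)].

End sampling.

(* Main.v *)
Require Import Defs.
From mathcomp Require Import all_boot all_order all_algebra.
From mathcomp Require Import all_classical all_reals all_analysis.
From mathcomp Require Import measurable_realfun.
From mathcomp Require Import ring lra.

Set Implicit Arguments.
Unset Strict Implicit.
Unset Printing Implicit Defensive.

Import Order.TTheory GRing.Theory Num.Theory.
Import numFieldNormedType.Exports.

Local Open Scope classical_set_scope.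
Local Open Scope ring_scope.

(** Write W_i = (V_i, X'_i) and let
      h(w, w') = K(v, v') + K(v_x', v'_x') - K(v, v'_x') - K(v_x', v')
    be the discrepancy kernel, where v_x' is v with its x-component replaced by
    the resampled one.  The Gaussian kernel is positive semidefinite, so h is
    the inner product of the feature differences phi(w) = K(v, .) - K(v_x', .);
    moreover |h| <= 2, E h(W_1, W_2) = zeta, and the statistic is the
    U-statistic of h.  Two facts give the theorem.

    The critical value is O(1/n) for every data set.  Exchanging the two
    x-components of observation i changes the sign of phi(W_i), so the swapped
    statistics are the values of a Rademacher chaos of order two with
    coefficients h(W_i, W_j).  Its mean square over all sign patterns is at most
    4 / C(n, 2), and Chebyshev's inequality shows that any s > 0 with
    alpha s^2 C(n, 2) >= 4 lies above the critical value
    ([crit_lt_of_large]).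

    The statistic is at least zeta / 16 with probability at least
    1 - 32 / (n zeta) ([ustat_lower_bound]).  In the feature space the empirical
    mean of the phi(W_i) is at mean square distance O(1/n) from its expectation,
    whose squared norm is zeta; hence its squared norm is rarely below a fixed
    fraction of zeta, and passing from the squared norm (a V-statistic) to the
    U-statistic costs only O(1/n).  In the proof the empirical mean of a ghost
    copy of the sample stands for the expectation in the feature space, so that
    each inequality between norms is the nonnegativity of a finite quadratic
    form, integrated over the ghost copy.

    When n >= 2 and n zeta >= 64 / alpha, the value s = zeta / 16 satisfies
    alpha s^2 C(n, 2) >= 4, so the power is at least 1 - 32 / (n zeta)
    ([test_power_lower_bound]), whatever the dimensions are. *)

(** * Positive semidefinite kernels *)

Section positive_semidefinite.
Context {R : realType}.

Definition psd (T : Type) (k : T -> T -> R) : Prop :=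
  forall (I : finType) (c : I -> R) (x : I -> T),
    0 <= \sum_i \sum_j c i * c j * k (x i) (x j).

Lemma eq_psd T (k k' : T -> T -> R) : k =2 k' -> psd k -> psd k'.
Proof.
move=> kk' psdk I c x; under eq_bigr do under eq_bigr do rewrite -kk'.
exact: psdk.
Qed.

Lemma psd1 T : psd (fun _ _ : T => 1).
Proof.
move=> I c x; rewrite (_ : \sum_i _ = (\sum_i c i) ^+ 2) ?sqr_ge0//.
rewrite expr2 mulr_suml; apply: eq_bigr => i _.
by rewrite mulr_sumr; apply: eq_bigr => j _; rewrite mulr1.
Qed.

Lemma psd_reweight T (f : T -> R) (k : T -> T -> R) :
  psd k -> psd (fun x y => f x * f y * k x y).
Proof.
move=> psdk I c x; rewrite (_ : \sum_i _ =
  \sum_i \sum_j (c i * f (x i)) * (c j * f (x j)) * k (x i) (x j)).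
  exact: (psdk I (fun i => c i * f (x i))).
by apply: eq_bigr => i _; apply: eq_bigr => j _; ring.
Qed.

Lemma psd_scale T (a : R) (k : T -> T -> R) :
  0 <= a -> psd k -> psd (fun x y => a * k x y).
Proof.
move=> a0 psdk I c x; rewrite (_ : \sum_i _ =
  a * \sum_i \sum_j c i * c j * k (x i) (x j)); first exact: mulr_ge0.
rewrite mulr_sumr; apply: eq_bigr => i _.
by rewrite mulr_sumr; apply: eq_bigr => j _; ring.
Qed.

Lemma psd_sum T (L : Type) (r : seq L) (k : L -> T -> T -> R) :
  (forall l, psd (k l)) -> psd (fun x y => \sum_(l <- r) k l x y).
Proof.
move=> psdk I c x; rewrite (_ : \sum_i _ =
  \sum_(l <- r) \sum_i \sum_j c i * c j * k l (x i) (x j)).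
  by apply: sumr_ge0 => l _; exact: psdk.
rewrite [RHS]exchange_big/=; apply: eq_bigr => i _.
by rewrite [RHS]exchange_big/=; apply: eq_bigr => j _; rewrite mulr_sumr.
Qed.

Lemma psd_cvg T (k_ : nat -> T -> T -> R) (k : T -> T -> R) :
  (forall n, psd (k_ n)) -> (forall x y, k_ n x y @[n --> \oo] --> k x y) ->
  psd k.
Proof.
move=> psdk kcvg I c x.
have lim : \sum_i \sum_j c i * c j * k_ n (x i) (x j) @[n --> \oo] -->
           \sum_i \sum_j c i * c j * k (x i) (x j).
  apply: cvg_big => // [|i _]; first exact: add_continuous.
  apply: cvg_big => // [|j _]; first exact: add_continuous.
  by apply: cvgM; [exact: cvg_cst|exact: kcvg].
rewrite -(cvg_lim _ lim)//; apply: limr_ge; first exact: cvgP lim.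
by apply: nearW => n; exact: psdk.
Qed.

(** The quadratic form of [k] at the union of two families of points, with its
    four blocks separated. *)
Lemma psd_pair T (k : T -> T -> R) (I : finType) (c c' : I -> R) (x x' : I -> T) :
  psd k ->
  0 <= \sum_i \sum_j (c i * c j * k (x i) (x j) + c i * c' j * k (x i) (x' j)
                    + c' i * c j * k (x' i) (x j)
                    + c' i * c' j * k (x' i) (x' j)).
Proof.
move=> psdk.
pose d (p : I * bool) := if p.2 then c p.1 else c' p.1.
pose y (p : I * bool) := if p.2 then x p.1 else x' p.1.
apply: le_trans (psdk _ d y) _.
rewrite le_eqVlt; apply/orP; left; apply/eqP.
rewrite -(pair_bigA _ (fun i b => \sum_q d (i, b) * d q * k (y (i, b)) (y q))).
apply: eq_bigr => i _; rewrite big_bool/= -big_split/=.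
rewrite -(pair_bigA _ (fun j b => d (i, true) * d (j, b) *
  k (y (i, true)) (y (j, b)) + d (i, false) * d (j, b) *
  k (y (i, false)) (y (j, b)))).
by apply: eq_bigr => j _; rewrite big_bool/= /d /y/=; ring.
Qed.

(** The form of the new kernel with weights [c] is the form of [k] with weights
    [c] at the points [f x] and [- c] at the points [g x]. *)
Lemma psd_diff T S (k : T -> T -> R) (f g : S -> T) : psd k ->
  psd (fun a b => k (f a) (f b) + k (g a) (g b) - k (f a) (g b) - k (g a) (f b)).
Proof.
move=> psdk I c x.
have := psd_pair c (fun i => - c i) (f \o x) (g \o x) psdk.
congr (0 <= _); apply: eq_bigr => i _; apply: eq_bigr => j _ /=; ring.
Qed.

Definition dot {d : nat} (u v : d.-tuple R) : R :=
  \sum_(l < d) tnth u l * tnth v l.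

(** A power of the inner product gains one factor as a sum over coordinates of
    rank-one reweightings, and these preserve positive semidefiniteness. *)
Lemma psd_dotX d n : psd (fun u v : d.-tuple R => dot u v ^+ n).
Proof.
elim: n => [|n IHn]; first exact: psd1.
apply: (@eq_psd _
  (fun u v => \sum_(l < d) tnth u l * tnth v l * dot u v ^+ n)).
  by move=> u v; rewrite exprS -mulr_suml.
by apply: psd_sum => l; exact: (psd_reweight (fun u => tnth u l)).
Qed.

(** The partial sums of the exponential series have nonnegative coefficients. *)
Lemma psd_exp_dot d (s : R) : 0 <= s ->
  psd (fun u v : d.-tuple R => expR (s * dot u v)).
Proof.
move=> s0.
apply: (@psd_cvg _ (fun n u v => series (exp_coeff (s * dot u v)) n)).
  move=> n; rewrite /series/=.
  apply: psd_sum => m.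
  apply: (@eq_psd _ (fun u v => (s ^+ m / m`!%:R) * dot u v ^+ m)).
    by move=> u v; rewrite /exp_coeff/= exprMn; ring.
  by apply: psd_scale; [rewrite divr_ge0 ?exprn_ge0|exact: psd_dotX].
by move=> u v; exact: is_cvg_series_exp_coeff.
Qed.

Lemma sqdist_dot d (u v : d.-tuple R) :
  sqdist u v = dot u u + dot v v - 2 * dot u v.
Proof.
rewrite /sqdist /dot mulr_sumr -big_split -sumrB/=.
by apply: eq_bigr => l _; ring.
Qed.

(** Expanding the squared distance turns the Gaussian kernel into a reweighting
    of the exponential of the inner product. *)
Lemma psd_gaussK d (sigma : R) : psd (@gaussK R sigma d).
Proof.
pose s := sigma ^+ 2; pose f (u : d.-tuple R) := expR (- (s * dot u u / 2)).
apply: (@eq_psd _ (fun u v => f u * f v * expR (s * dot u v))).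
  move=> u v; rewrite /f -!expRD /gaussK sqdist_dot -/s; congr expR.
  by field.
apply: psd_reweight; apply: psd_exp_dot; exact: sqr_ge0.
Qed.

End positive_semidefinite.

(** * Rademacher chaos of order two *)

Section rademacher_chaos.
Context {R : realType} (n : nat).
Implicit Type p : {ffun 'I_n -> bool}.

Definition eps p (i : 'I_n) : R := if p i then 1 else -1.

Definition flip (i : 'I_n) p : {ffun 'I_n -> bool} :=
  [ffun k => p k (+) (k == i)].

Lemma flipK i : involutive (flip i).
Proof. by move=> p; apply/ffunP => k; rewrite !ffunE -addbA addbb addbF. Qed.

Lemma eps_flip i p k : eps (flip i p) k = (if k == i then -1 else 1) * eps p k.
Proof. by rewrite /eps ffunE; case: (k == i); case: (p k) => /=; ring. Qed.

Lemma epsM p i : eps p i * eps p i = 1.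
Proof. by rewrite /eps; case: (p i); ring. Qed.

Lemma sum_flip_odd i (f : {ffun 'I_n -> bool} -> R) :
  (forall p, f (flip i p) = - f p) -> \sum_p f p = 0.
Proof.
move=> fN; have : \sum_p f p = - \sum_p f p.
  rewrite [LHS](reindex_inj (inv_inj (flipK i))) -sumrN.
  by apply: eq_bigr => p _; rewrite fN.
lra.
Qed.

(** For two different pairs some index occurs in only one of them, and flipping
    its sign cancels the sum. *)
Lemma sum_eps4 (i j k l : 'I_n) : (i < j)%N -> (k < l)%N ->
  \sum_p (eps p i * eps p j) * (eps p k * eps p l) =
  if (i == k) && (j == l) then 2 ^+ n else 0.
Proof.
move=> ij kl.
have [/andP[/eqP <- /eqP <-]|] := boolP ((i == k) && (j == l)).
  under eq_bigr do rewrite mulrACA !epsM mulr1.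
  by rewrite sumr_const card_ffun card_bool card_ord natrX.
rewrite negb_and => ne.
have [/andP[ik il]|] := boolP ((i != k) && (i != l)).
  apply: (sum_flip_odd (i := i)) => p; rewrite !eps_flip eqxx.
  rewrite [k == i]eq_sym (negbTE ik) [l == i]eq_sym (negbTE il).
  have -> : (j == i) = false by apply/negbTE; rewrite neq_ltn ij orbT.
  by ring.
rewrite negb_and !negbK => iE.
have [/andP[jk jl]|] := boolP ((j != k) && (j != l)).
  apply: (sum_flip_odd (i := j)) => p; rewrite !eps_flip eqxx.
  rewrite [k == j]eq_sym (negbTE jk) [l == j]eq_sym (negbTE jl).
  have -> : (i == j) = false by apply/negbTE; rewrite neq_ltn ij.
  by ring.
rewrite negb_and !negbK => jE; exfalso.
case/orP: iE => /eqP ei; case/orP: jE => /eqP ej.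
- by move: ij; rewrite ei ej ltnn.
- by move: ne; rewrite ei ej !eqxx.
- by move: (ltn_trans ij (leq_ltn_trans (eq_leq (congr1 val ej)) kl));
    rewrite ei ltnn.
- by move: ij; rewrite ei ej ltnn.
Qed.

Definition chaos (a : 'I_n -> 'I_n -> R) p : R :=
  \sum_(i < n) \sum_(j < n | (i < j)%N) eps p i * eps p j * a i j.

(** The products [eps p i * eps p j] with [i < j] are orthonormal for the uniform
    distribution on sign patterns. *)
Lemma sum_chaos_sqr a :
  \sum_p chaos a p ^+ 2 =
  2 ^+ n * \sum_(i < n) \sum_(j < n | (i < j)%N) a i j ^+ 2.
Proof.
pose I2 := ('I_n * 'I_n)%type.
pose D (q : I2) := (q.1 < q.2)%N.
have chaosE p : chaos a p = \sum_(q : I2 | D q) eps p q.1 * eps p q.2 * a q.1 q.2.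
  by rewrite /chaos pair_big_dep.
under eq_bigr do rewrite chaosE expr2 mulr_suml.
rewrite [X in _ = _ * X]pair_big_dep/= exchange_big/= mulr_sumr.
apply: eq_bigr => -[i j] /= ij; rewrite /D/= in ij.
under eq_bigr do rewrite mulr_sumr.
rewrite exchange_big/= (bigD1 (i, j))//= [X in _ + X]big1 ?addr0.
  rewrite (eq_bigr (fun p => (eps p i * eps p j) * (eps p i * eps p j) *
    a i j ^+ 2)); last by move=> p _; ring.
  by rewrite -mulr_suml sum_eps4// !eqxx/=.
move=> [k l]/= /andP[kl ne].
rewrite (eq_bigr (fun p => (eps p i * eps p j) * (eps p k * eps p l) *
  (a i j * a k l))); last by move=> p _; ring.
rewrite -mulr_suml sum_eps4//.
have -> : (i == k) && (j == l) = false; last by rewrite mul0r.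
apply/negbTE; apply: contra ne => /andP[/eqP-> /eqP->].
by rewrite eqxx.
Qed.

Lemma card_ltn_pairs : \sum_(i < n) \sum_(j < n | (i < j)%N) (1 : R) = 'C(n, 2)%:R.
Proof.
rewrite (exchange_big_dep xpredT)//=.
transitivity ((\sum_(j < n) (j : nat))%:R : R); last first.
  congr (_%:R); rewrite -(big_mkord xpredT id).
  by rewrite bin2_sum.
rewrite natr_sum; apply: eq_bigr => j _.
by rewrite (big_ord_narrow (ltnW (ltn_ord j))) sumr_const card_ord.
Qed.

End rademacher_chaos.

(** * The critical value *)

(** An empirical quantile is attained at one of the data points, so it lies below
    [s] as soon as enough data points do.  In this form the rejection event is a
    comparison of finitely many statistics, which also makes it measurable. *)
Lemma lt_empirical_quantile {R : realType} (I : finType) (f : I -> R)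
    (c q s : R) : 0 <= c -> 0 < q -> q <= c * #|I|%:R ->
  (inf [set t : R | q <= c * \sum_p (f p <= t)%R%:R] < s) =
  (q <= c * \sum_p (f p < s)%R%:R).
Proof.
move=> c0 q0 qI; set A := [set t : R | _].
have mono (b b' : pred I) : subpred b b' ->
    c * \sum_p (b p)%:R <= c * \sum_p (b' p)%:R.
  move=> bb'; apply: ler_wpM2l => //; apply: ler_sum => p _.
  by rewrite ler_nat; case: (b p) (bb' p) => // ->.
have Aex (b : pred I) : q <= c * \sum_p (b p)%:R -> exists p, b p.
  move=> qb; apply/existsP/negP => /pred0P b0.
  move: qb; rewrite big1 ?mulr0 ?leNgt ?q0// => p _.
  by have := b0 p; rewrite /= => ->.
have A0 : A !=set0.
  exists (\sum_p `|f p|); rewrite /A/=.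
  apply: le_trans qI _; apply: ler_wpM2l => //.
  rewrite -sum1_card natr_sum; apply: ler_sum => p _.
  rewrite ler_nat lt0b; apply: le_trans (ler_norm _) _.
  by rewrite (bigD1 p)//= lerDl sumr_ge0.
have Alb : has_lbound A.
  exists (- \sum_p `|f p|) => t /Aex[p fpt]; apply: le_trans fpt.
  rewrite lerNl; apply: le_trans (ler_norm _) _; rewrite normrN.
  by rewrite (bigD1 p)//= lerDl sumr_ge0.
apply/idP/idP => [/inf_lt[]// t At ts|qs].
  apply: le_trans At (mono _ _ _) => p /= fpt; exact: le_lt_trans ts.
have [p0 fp0] := Aex _ qs.
pose m := [arg max_(p > p0 | f p < s) f p]%O.
have [fms fm] : f m < s /\ forall p, f p < s -> f p <= f m.
  by rewrite /m; case: arg_maxP.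
apply: le_lt_trans fms; apply: ge_inf => //.
by apply: le_trans qs (mono _ _ _) => p /= /fm.
Qed.

Section test_statistic.
Context {R : realType} {dx dy dz : nat} (sigma : R).
Local Notation obsX := (obs R dx dy dz * dx.-tuple R)%type.

(** The discrepancy kernel, on pairs (v, x') of an observation and its resampled
    x-component. *)
Definition discr_ker (w w' : obsX) : R :=
  Kobs sigma w.1 w'.1 + Kobs sigma (replX w.1 w.2) (replX w'.1 w'.2)
  - Kobs sigma w.1 (replX w'.1 w'.2) - Kobs sigma (replX w.1 w.2) w'.1.

Lemma sqdist_ge0 d (u v : d.-tuple R) : 0 <= sqdist u v.
Proof. by apply: sumr_ge0 => k _; exact: sqr_ge0. Qed.

Lemma sqdistC d (u v : d.-tuple R) : sqdist u v = sqdist v u.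
Proof. by apply: eq_bigr => k _; rewrite -sqrrN opprB. Qed.

Lemma KobsC (v w : obs R dx dy dz) : Kobs sigma v w = Kobs sigma w v.
Proof.
by rewrite /Kobs /gaussK sqdistC.
Qed.

Lemma Kobs_bounds (v w : obs R dx dy dz) : 0 <= Kobs sigma v w <= 1.
Proof.
rewrite /Kobs /gaussK expR_ge0 -expR0 ler_expR oppr_le0.
by rewrite divr_ge0// mulr_ge0 ?sqr_ge0// sqdist_ge0.
Qed.

Lemma discr_kerC w w' : discr_ker w w' = discr_ker w' w.
Proof.
rewrite /discr_ker ![Kobs sigma w'.1 _]KobsC.
by rewrite ![Kobs sigma (replX w'.1 _) _]KobsC; ring.
Qed.

Lemma discr_ker_le2 w w' : `|discr_ker w w'| <= 2.
Proof.
rewrite ler_norml /discr_ker.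
have /andP[? ?] := Kobs_bounds w.1 w'.1.
have /andP[? ?] := Kobs_bounds (replX w.1 w.2) (replX w'.1 w'.2).
have /andP[? ?] := Kobs_bounds w.1 (replX w'.1 w'.2).
have /andP[? ?] := Kobs_bounds (replX w.1 w.2) w'.1.
by apply/andP; split; lra.
Qed.

Lemma psd_discr_ker : psd discr_ker.
Proof.
apply: (psd_diff (fun w : obsX => w.1) (fun w => replX w.1 w.2)).
move=> I c x; exact: (psd_gaussK _ c (fun i => vec (x i))).
Qed.

Context {n : nat} (V : 'I_n -> obs R dx dy dz) (X' : 'I_n -> dx.-tuple R).
Let a i j := discr_ker (V i, X' i) (V j, X' j).

(** Exchanging the two x-components of observation [i] negates the feature
    difference of [W_i]. *)
Lemma stat_swapE p : stat_swap sigma V X' p = ('C(n, 2)%:R)^-1 * chaos a p.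
Proof.
rewrite /stat_swap /stat /zeta_hat; congr (_ * _).
apply: eq_bigr => i _; apply: eq_bigr => j _.
have VE k : replX (V k) (V k).1.1 = V k by case: (V k) => [[]].
rewrite /a /discr_ker /eps /=.
by case: (p i); case: (p j); rewrite /= /replX/= -/(replX _ _) ?VE; ring.
Qed.

Lemma statE : stat sigma V X' =
  ('C(n, 2)%:R)^-1 * \sum_(i < n) \sum_(j < n | (i < j)%N) a i j.
Proof. by []. Qed.

Lemma crit_lt (alpha s : R) : 0 < alpha < 1 ->
  (crit sigma alpha V X' < s) =
  (1 - alpha <= (2 ^+ n)^-1 *
     \sum_(p : {ffun 'I_n -> bool}) (stat_swap sigma V X' p < s)%R%:R).
Proof.
move=> /andP[a0 a1]; apply: lt_empirical_quantile.
- by rewrite invr_ge0 exprn_ge0.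
- by rewrite subr_gt0.
- by rewrite card_ffun card_bool card_ord natrX mulVf ?expf_neq0//; lra.
Qed.

(** Chebyshev's inequality for the chaos of [stat_swapE], whose mean square is at
    most [4 / 'C(n, 2)] because the discrepancy kernel is bounded by 2: at most a
    fraction [alpha] of the swapped statistics can reach [s]. *)
Lemma crit_lt_of_large (alpha s : R) : 0 < alpha < 1 -> 0 < s -> (1 < n)%N ->
  4 <= alpha * s ^+ 2 * 'C(n, 2)%:R -> crit sigma alpha V X' < s.
Proof.
move=> a01 s0 n1 large; rewrite crit_lt//.
set N : R := 'C(n, 2)%:R in large.
have N0 : 0 < N by rewrite /N ltr0n bin_gt0.
have P0 : 0 < (2 : R) ^+ n by rewrite exprn_gt0.
pose u p := stat_swap sigma V X' p.
have markov_p p : (s <= u p)%R%:R * s ^+ 2 <= u p ^+ 2.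
  have [sp|_] := leP s (u p); last by rewrite /= mul0r sqr_ge0.
  by rewrite mul1r ler_sqr ?nnegrE ?(ltW s0)// (le_trans (ltW s0) sp).
have sum_u2 : \sum_p u p ^+ 2 <= 2 ^+ n * (4 / N).
  under eq_bigr do rewrite /u stat_swapE exprMn.
  rewrite -mulr_sumr sum_chaos_sqr -/N mulrCA ler_pM2l//.
  have : \sum_(i < n) \sum_(j < n | (i < j)%N) a i j ^+ 2 <= 4 * N.
    rewrite /N -card_ltn_pairs mulr_sumr; apply: ler_sum => i _.
    rewrite mulr_sumr; apply: ler_sum => j _.
    rewrite mulr1 -real_normK ?num_real//.
    have := discr_ker_le2 (V i, X' i) (V j, X' j); rewrite -/(a i j) => ale.
    have : 0 <= `|a i j| by []. 
    nra.
  move=> h; rewrite exprVn mulrC ler_pdivrMr ?exprn_gt0//.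
  by rewrite (le_trans h)// expr2 mulrA divfK// lt0r_neq0.
have tail : \sum_(p : {ffun 'I_n -> bool}) (s <= u p)%R%:R <= alpha * 2 ^+ n.
  have s20 : 0 < s ^+ 2 by rewrite exprn_gt0.
  rewrite -(ler_pM2r s20) mulr_suml.
  apply: le_trans (ler_sum _ (fun p _ => markov_p p)) _.
  apply: le_trans sum_u2 _; rewrite [alpha * _]mulrC -mulrA ler_pM2l//.
  by rewrite ler_pdivrMr.
have -> : \sum_(p : {ffun 'I_n -> bool}) (u p < s)%R%:R =
    2 ^+ n - \sum_(p : {ffun 'I_n -> bool}) (s <= u p)%R%:R :> R.
  rewrite (_ : 2 ^+ n = \sum_(p : {ffun 'I_n -> bool}) 1); last first.
    by rewrite sumr_const card_ffun card_bool card_ord natrX.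
  by rewrite -sumrB; apply: eq_bigr => p _; case: ltP; rewrite /= ?subr0 ?subrr.
by rewrite mulrC ler_pdivlMr//; lra.
Qed.

End test_statistic.

(** * Means of bounded measurable functions *)

Section bounded_measurable.
Context {R : realType}.

Definition bounded_meas d (T : measurableType d) (f : T -> R) : Prop :=
  measurable_fun [set: T] f /\ exists c : R, forall x, `|f x| <= c.

Section closure.
Context d (T : measurableType d).
Implicit Types (f g : T -> R).

Lemma bounded_meas_cst (a : R) : bounded_meas (fun _ : T => a).
Proof. by split; [exact: measurable_cst|exists `|a|]. Qed.

Lemma bounded_measD f g :
  bounded_meas f -> bounded_meas g -> bounded_meas (fun x => f x + g x).
Proof.
move=> [mf [c fc]] [mg [e ge]]; split; first exact: measurable_funD.
by exists (c + e) => x; rewrite (le_trans (ler_normD _ _))// lerD.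
Qed.

Lemma bounded_measM f g :
  bounded_meas f -> bounded_meas g -> bounded_meas (fun x => f x * g x).
Proof.
move=> [mf [c fc]] [mg [e ge]]; split; first exact: measurable_funM.
by exists (c * e) => x; rewrite normrM ler_pM.
Qed.

Lemma bounded_measB f g :
  bounded_meas f -> bounded_meas g -> bounded_meas (fun x => f x - g x).
Proof.
move=> [mf [c fc]] [mg [e ge]]; split; first exact: measurable_funB.
by exists (c + e) => x; rewrite (le_trans (ler_normB _ _))// lerD.
Qed.

Lemma bounded_meas_sum (I : Type) (r : seq I) (P : pred I) (f : I -> T -> R) :
  (forall i, bounded_meas (f i)) ->
  bounded_meas (fun x => \sum_(i <- r | P i) f i x).
Proof.
move=> bf; elim: r => [|i r IHr].
  by under eq_fun do rewrite big_nil; exact: bounded_meas_cst.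
under eq_fun do rewrite big_cons.
by case: (P i) => //; exact: bounded_measD.
Qed.

Lemma bounded_meas_comp d' (T' : measurableType d') (f : T' -> R) (h : T -> T') :
  measurable_fun setT h -> bounded_meas f -> bounded_meas (f \o h).
Proof.
move=> mh [mf [c fc]]; split; first exact: measurableT_comp.
by exists c => x; exact: fc.
Qed.

Lemma measurable_ge_fun f (a : R) :
  measurable_fun setT f -> measurable [set x | a <= f x].
Proof.
move=> mf; rewrite -[X in measurable X]setTI.
have := mf measurableT _ (measurable_itv `[a, +oo[).
by congr (measurable (_ `&` _)); apply/seteqP; split => x /=;
  rewrite in_itv/= andbT.
Qed.

Context (mu : probability T R).

Lemma bounded_meas_integrable f :
  bounded_meas f -> mu.-integrable setT (EFin \o f).
Proof.
move=> [mf [c fc]]; apply/integrableP; split; first exact/measurable_EFinP.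
apply: (@le_lt_trans _ _ (\int[mu]_x (c%:E))%E).
  apply: ge0_le_integral => //=.
  - by apply/measurable_EFinP; exact: measurableT_comp.
  - by move=> x _; rewrite lee_fin; exact: fc.
by rewrite integral_cst//= probability_setT mule1 ltry.
Qed.

Lemma mean_cst (a : R) : \int[mu]_x a = a.
Proof. by rewrite Rintegral_cst//= probability_setT mulr1. Qed.

Lemma meanD f g : bounded_meas f -> bounded_meas g ->
  \int[mu]_x (f x + g x) = \int[mu]_x f x + \int[mu]_x g x.
Proof. by move=> bf bg; rewrite RintegralD//; exact: bounded_meas_integrable. Qed.

Lemma meanB f g : bounded_meas f -> bounded_meas g ->
  \int[mu]_x (f x - g x) = \int[mu]_x f x - \int[mu]_x g x.
Proof. by move=> bf bg; rewrite RintegralB//; exact: bounded_meas_integrable. Qed.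

Lemma meanZ a f : bounded_meas f -> \int[mu]_x (a * f x) = a * \int[mu]_x f x.
Proof. by move=> bf; rewrite RintegralZl//; exact: bounded_meas_integrable. Qed.

Lemma mean_sum (I : Type) (r : seq I) (P : pred I) (f : I -> T -> R) :
  (forall i, bounded_meas (f i)) ->
  \int[mu]_x (\sum_(i <- r | P i) f i x) =
  \sum_(i <- r | P i) \int[mu]_x f i x.
Proof.
move=> bf; elim: r => [|i r IHr].
  by rewrite big_nil; under eq_Rintegral do rewrite big_nil; rewrite mean_cst.
rewrite big_cons; under eq_Rintegral do rewrite big_cons.
case: (P i) => //; rewrite meanD ?IHr//; exact: bounded_meas_sum.
Qed.

Lemma mean_law d' (T' : measurableType d') (nu : probability T' R)
    (h : T -> T') (f' : T' -> R) : measurable_fun setT h ->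
  (forall A, measurable A -> mu (h @^-1` A) = nu A) -> bounded_meas f' ->
  \int[mu]_x f' (h x) = \int[nu]_y f' y.
Proof.
move=> mh munu bf'; rewrite /Rintegral; congr fine.
pose X : {RV mu >-> T'} := mfun_Sub (mem_set mh).
transitivity (\int[distribution mu X]_y (f' y)%:E)%E; last first.
  by apply: eq_measure_integral => A mA _; exact: munu.
rewrite integral_distribution//.
- by apply/measurable_EFinP; case: bf'.
- exact/bounded_meas_integrable/bounded_meas_comp.
Qed.

Lemma markov_mean f (a : R) : bounded_meas f -> (forall x, 0 <= f x) -> 0 < a ->
  fine (mu [set x | a <= f x]) <= \int[mu]_x f x / a.
Proof.
move=> bf f0 a0; rewrite ler_pdivlMr// mulrC.
have [mf _] := bf.
pose X : {RV mu >-> R} := mfun_Sub (mem_set mf).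
have := @markov _ _ _ mu X id a a0 (@measurable_id _ _ _) (fun _ => id).
have -> : [set x | a%:E <= `|(X x)%:E|]%E = [set x | a <= f x].
  by apply/seteqP; split => x /=; rewrite lee_fin ger0_norm.
rewrite unlock => /(_ (fun _ _ _ _ => id)).
under eq_integral => x _ do rewrite /= ger0_norm//.
rewrite /Rintegral -lee_fin EFinM !fineK//.
- exact/integrable_fin_num/bounded_meas_integrable.
- exact/fin_num_measure/measurable_ge_fun.
Qed.

End closure.

Section product.
Context d1 d2 (T1 : measurableType d1) (T2 : measurableType d2).
Context (mu : probability T1 R) (nu : probability T2 R) (f : T1 * T2 -> R).
Hypothesis bf : bounded_meas f.

Lemma bounded_meas_section x : bounded_meas (fun y => f (x, y)).
Proof. by apply: bounded_meas_comp bf; exact: pair1_measurable. Qed.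

Let int_f : (mu \x nu)%E.-integrable setT (EFin \o f).
Proof. exact: bounded_meas_integrable. Qed.

Let F_fin x : (\int[nu]_y f (x, y))%:E = (\int[nu]_y (f (x, y))%:E)%E.
Proof.
rewrite /Rintegral fineK//; apply: integrable_fin_num => //.
exact/(bounded_meas_integrable nu)/bounded_meas_section.
Qed.

Lemma bounded_meas_mean2 : bounded_meas (fun x => \int[nu]_y f (x, y)).
Proof.
split.
  apply/measurable_EFinP.
  rewrite (_ : EFin \o _ = fubini_F nu (EFin \o f)); last by apply/funext.
  exact: measurable_fubini_F int_f.
case: (bf) => _ [c fc]; exists c => x.
have int_fx := bounded_meas_integrable nu (bounded_meas_section x).
apply: le_trans (le_normr_Rintegral _ int_fx) _ => //.
rewrite -[leRHS](mean_cst nu); apply: le_Rintegral => //.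
- apply: bounded_meas_integrable; split.
    by apply: measurableT_comp => //; case: (bounded_meas_section x).
  by exists c => y; rewrite normr_id.
- exact/bounded_meas_integrable/bounded_meas_cst.
Qed.

Lemma mean_mean2 : \int[mu]_x (\int[nu]_y f (x, y)) = \int[(mu \x nu)%E]_z f z.
Proof.
rewrite {1 3}/Rintegral; congr fine; rewrite -integral12_prod_meas1//.
by apply: eq_integral => x _; rewrite F_fin.
Qed.

End product.

End bounded_measurable.

(** * Lower tail of a positive semidefinite U-statistic *)

Section degenerate_lower_bound.
Context {R : realType} d (T : measurableType d) (mu : probability T R).
Context dS (S : measurableType dS) (J : probability S R).
Context (k : S -> S -> R) (c : R).
Hypothesis k_meas : measurable_fun setT (fun w : S * S => k w.1 w.2).
Hypothesis k_le : forall x y, `|k x y| <= c.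
Hypothesis kC : forall x y, k x y = k y x.
Hypothesis psdk : psd k.
Context (n : nat) (W : 'I_n -> T -> S).
Hypothesis W_meas : forall i, measurable_fun setT (W i).
Hypothesis W_law : forall i A, measurable A -> mu (W i @^-1` A) = J A.
Hypothesis W_law2 : forall i j A, i != j -> measurable A ->
  mu ((fun t => (W i t, W j t)) @^-1` A) = (J \x J)%E A.

(* With phi a feature map of k: theta is the squared norm of m = E phi(W), g x is
   <phi x, m>, S_ is the squared norm of sum_i phi(W_i), and M_ is
   <sum_i phi(W_i), m>. *)
Let theta := \int[(J \x J)%E]_w k w.1 w.2.
Let g x := \int[J]_y k x y.
Let S_ t := \sum_i \sum_j k (W i t) (W j t).
Let M_ t := \sum_i g (W i t).

Let bk : bounded_meas (fun w : S * S => k w.1 w.2).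
Proof. by split=> //; exists c => w; exact: k_le. Qed.

Let bg : bounded_meas g. Proof. exact: (bounded_meas_mean2 J J bk). Qed.

Let bkW i j : bounded_meas (fun t => k (W i t) (W j t)).
Proof.
apply: (bounded_meas_comp (h := fun t => (W i t, W j t)) _ bk).
by apply/measurable_fun_pairP; split; exact: W_meas.
Qed.

Let bkx x j : bounded_meas (fun t => k x (W j t)).
Proof.
by apply: (bounded_meas_comp (h := W j) _ (bounded_meas_section bk x)).
Qed.

Let bgW i : bounded_meas (fun t => g (W i t)).
Proof. exact: (bounded_meas_comp (W_meas i) bg). Qed.

Let bS : bounded_meas S_.
Proof. by apply: bounded_meas_sum => i; exact: bounded_meas_sum. Qed.

Let bM : bounded_meas M_. Proof. exact: bounded_meas_sum. Qed.

Let mean_kx x j : \int[mu]_t k x (W j t) = g x.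
Proof.
apply: (mean_law (h := W j) (f' := k x)) => //.
- exact: W_law.
- exact: (bounded_meas_section bk x).
Qed.

Let mean_gW i : \int[mu]_t g (W i t) = theta.
Proof.
rewrite (mean_law (h := W i) (nu := J))//; last exact: W_law.
exact: (mean_mean2 J J bk).
Qed.

Let mean_kW i j : i != j -> \int[mu]_t k (W i t) (W j t) = theta.
Proof.
move=> ij.
apply: (mean_law (h := fun t => (W i t, W j t)) (f' := fun w => k w.1 w.2)) => //.
- by apply/measurable_fun_pairP; split; exact: W_meas.
- by move=> A mA; exact: W_law2.
Qed.

Let mean_M : \int[mu]_t M_ t = n%:R * theta.
Proof.
rewrite mean_sum//; under eq_bigr do rewrite mean_gW.
by rewrite sumr_const card_ord mulr_natl.
Qed.

Let diag_ge0 x : 0 <= k x x.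
Proof.
have := psdk (fun _ : 'I_1 => 1) (fun=> x).
by rewrite !big_ord1 !mul1r.
Qed.

Let mean_S : n%:R * (n%:R - 1) * theta <= \int[mu]_t S_ t
  <= n%:R * (n%:R - 1) * theta + n%:R * c.
Proof.
have ES : \int[mu]_t S_ t =
    n%:R * (n%:R - 1) * theta + \sum_i \int[mu]_t k (W i t) (W i t).
  rewrite mean_sum => [|i]; last exact: bounded_meas_sum.
  transitivity (\sum_(i < n)
      ((n%:R - 1) * theta + \int[mu]_t k (W i t) (W i t))).
    apply: eq_bigr => i _; rewrite mean_sum// (bigD1 i)//= addrC; congr (_ + _).
    rewrite (eq_bigr (fun=> theta)); last first.
      by move=> j; rewrite eq_sym; exact: mean_kW.
    rewrite sumr_const cardC1 card_ord -[LHS]mulr_natl -subn1 natrB//.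
    exact: leq_ltn_trans (ltn_ord i).
  by rewrite big_split/= sumr_const card_ord -[X in X + _]mulr_natl mulrA.
rewrite ES; apply/andP; split.
  by rewrite lerDl; apply: sumr_ge0 => i _; exact: Rintegral_ge0.
rewrite lerD2l mulr_natl -[X in c *+ X](card_ord n) -sumr_const.
apply: ler_sum => i _; rewrite -[leRHS](mean_cst mu); apply: le_Rintegral => //.
- exact/bounded_meas_integrable.
- exact/bounded_meas_integrable/bounded_meas_cst.
- by move=> t _; rewrite (le_trans (ler_norm _)).
Qed.

(* The squared norm of a sum_i phi(W_i(t)) + b sum_j phi(W_j(u)) is nonnegative
   for every u; integrating over u, that is over an independent copy of the
   sample, makes the means of k appear. *)
Let ghost_ge0 (a b : R) t :
  0 <= a ^+ 2 * S_ t + 2 * a * b * (n%:R * M_ t) + b ^+ 2 * \int[mu]_u S_ u.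
Proof.
pose C u := \sum_i \sum_j k (W i t) (W j u).
have bC : bounded_meas C.
  by apply: bounded_meas_sum => i; exact: bounded_meas_sum.
have mean_C : \int[mu]_u C u = n%:R * M_ t.
  rewrite mean_sum => [|i]; last exact: bounded_meas_sum.
  rewrite mulr_sumr; apply: eq_bigr => i _; rewrite mean_sum//.
  under eq_bigr do rewrite mean_kx.
  by rewrite sumr_const card_ord mulr_natl.
have quad u : 0 <= a ^+ 2 * S_ t + (2 * a * b * C u + b ^+ 2 * S_ u).
  have := psd_pair (fun _ : 'I_n => a) (fun=> b) (W ^~ t) (W ^~ u) psdk.
  congr (0 <= _).
  under eq_bigr do rewrite !big_split/= -!mulr_sumr.
  rewrite !big_split/= -!mulr_sumr.
  have -> : \sum_i \sum_j k (W i u) (W j t) = C u.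
    rewrite exchange_big/=; apply: eq_bigr => i _; apply: eq_bigr => j _.
    exact: kC.
  by rewrite -/(C u) -/(S_ t) -/(S_ u); ring.
have := @Rintegral_ge0 _ _ _ mu setT _ (fun u _ => quad u).
have bZ x f : bounded_meas f -> bounded_meas (fun u : T => x * f u).
  exact/bounded_measM/bounded_meas_cst.
rewrite meanD; [|exact: bounded_meas_cst|by apply: bounded_measD; exact: bZ].
rewrite meanD; [|exact: bZ|exact: bZ].
by rewrite mean_cst !meanZ// mean_C addrA.
Qed.

(** [D] below is the mean squared distance between the feature sums of the sample
    and of a ghost copy.  Its own mean is of order n, so by Markov's inequality it
    rarely reaches the order n^2 theta; as long as it does not, the squared norm
    of the feature sum of the sample is comparable to that of its ghost copy,
    whose mean is at least n (n - 1) theta. *)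
Lemma ustat_lower_bound : (1 < n)%N -> 0 < theta -> 16 * c <= n%:R * theta ->
  1 - 16 * c / (n%:R * theta) <=
  fine (mu [set t | theta / 16 * 'C(n, 2)%:R <=
                    \sum_(i < n) \sum_(j < n | (i < j)%N) k (W i t) (W j t)]).
Proof.
move=> n1 theta0 nlarge.
pose U t := \sum_(i < n) \sum_(j < n | (i < j)%N) k (W i t) (W j t).
rewrite [leRHS](_ : _ = fine (mu [set t | theta / 16 * 'C(n, 2)%:R <= U t]))//.
have bU : bounded_meas U.
  by apply: bounded_meas_sum => i; exact: bounded_meas_sum.
have n2 : (2 : R) <= n%:R by rewrite ler_nat.
pose D t := S_ t - 2 * n%:R * M_ t + \int[mu]_u S_ u.
have bD : bounded_meas D.
  apply: bounded_measD; last exact: bounded_meas_cst.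
  apply: bounded_measD => //; under eq_fun do rewrite -mulNr.
  exact/bounded_measM/bM/bounded_meas_cst.
(* D t is the form of [ghost_ge0] for the difference of the two feature sums. *)
have D0 t : 0 <= D t.
  have := ghost_ge0 1 (-1) t; congr (0 <= _); rewrite /D; ring.
(* The parallelogram bound |y|^2 <= 2 |x|^2 + 2 |x - y|^2, in the form
   0 <= |2 x - y|^2. *)
have S_lb t : (\int[mu]_u S_ u) / 2 - D t <= S_ t.
  have := ghost_ge0 2 (-1) t; rewrite /D.
  by set m := M_ t; set s := S_ t; set e := (\int[mu]_u S_ u); lra.
have mean_D : \int[mu]_t D t <= 2 * n%:R * c.
  rewrite meanD; [| |exact: bounded_meas_cst]; last first.
    apply: bounded_measD => //; under eq_fun do rewrite -mulNr.
    exact/bounded_measM/bM/bounded_meas_cst.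
  under eq_Rintegral do rewrite -mulNr.
  rewrite mean_cst meanD//; last exact/bounded_measM/bM/bounded_meas_cst.
  rewrite meanZ// mean_M; have /andP[_] := mean_S.
  have : 0 <= n%:R * theta by rewrite mulr_ge0// ltW.
  by set e := (\int[mu]_u S_ u); nra.
have US t : S_ t = 2 * U t + \sum_i k (W i t) (W i t).
  have split i : \sum_j k (W i t) (W j t) =
      \sum_(j < n | (i < j)%N) k (W i t) (W j t) +
      \sum_(j < n | (j < i)%N) k (W i t) (W j t) + k (W i t) (W i t).
    rewrite (bigID (fun j : 'I_n => (i < j)%N))/= -addrA; congr (_ + _).
    rewrite (bigD1 i) ?ltnn//= addrC; congr (_ + _).
    by apply: eq_bigl => j; rewrite -leqNgt [RHS]ltn_neqAle andbC.
  rewrite /S_; under eq_bigr do rewrite split.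
  rewrite !big_split/= mulr_natl; congr (_ + _ + _).
  rewrite (exchange_big_dep xpredT)//=; apply: eq_bigr => i _.
  by apply: eq_bigr => j _; exact: kC.
have diag_le t : \sum_i k (W i t) (W i t) <= n%:R * c.
  rewrite mulr_natl -[X in c *+ X](card_ord n) -sumr_const.
  by apply: ler_sum => i _; exact: le_trans (ler_norm _) (k_le _ _).
have binE : 'C(n, 2)%:R * 2 = n%:R * (n%:R - 1) :> R.
  rewrite -natrM mulnC -mul_bin_diag bin1 natrM -subn1 natrB//; exact: ltnW.
have ES_lb : n%:R * (n%:R - 1) * theta <= \int[mu]_u S_ u by case/andP: mean_S.
have n0 : (0 : R) < n%:R by lra.
(* The mean of S_ is at least n^2 theta / 2, so half of it exceeds a by at least
   n^2 theta / 8; the diagonal terms take away at most n^2 theta / 16. *)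
pose a := n%:R ^+ 2 * theta / 8.
have a0 : 0 < a by rewrite divr_gt0// mulr_gt0// exprn_gt0.
have sub : ~` [set t | a <= D t] `<=` [set t | theta / 16 * 'C(n, 2)%:R <= U t].
  move=> t /=/negP; rewrite -ltNge => Dlt.
  have := S_lb t; have := US t; have := diag_le t; move: ES_lb Dlt; rewrite /a.
  set e := \int[mu]_u S_ u; set dg := \sum_i k (W i t) (W i t).
  move=> h1 h2 h3 h4 h5.
  have -> : 'C(n, 2)%:R = n%:R * (n%:R - 1) / 2 :> R by rewrite -binE; field.
  have h6 : n%:R * (16 * c) <= n%:R * (n%:R * theta) by rewrite ler_pM2l.
  have h7 : 0 <= n%:R * (n%:R - 2) * theta.
    by rewrite mulr_ge0 ?(ltW theta0)// mulr_ge0 ?subr_ge0 ?(ltW n0).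
  have h8 : 0 < n%:R * theta by rewrite mulr_gt0.
  lra.
have meas_D : measurable [set t | a <= D t] by apply: measurable_ge_fun; case: bD.
have le1 : 1 - fine (mu [set t | a <= D t]) <=
    fine (mu [set t | theta / 16 * 'C(n, 2)%:R <= U t]).
  have -> : 1 - fine (mu [set t | a <= D t]) = fine (mu (~` [set t | a <= D t])).
    by rewrite probability_setC// fineB// fin_num_measure.
  apply: fine_le; [exact/fin_num_measure/measurableC| |].
    by apply: fin_num_measure; apply: measurable_ge_fun; case: bU.
  apply: le_measure => //; rewrite inE; first exact: measurableC.
  by apply: measurable_ge_fun; case: bU.
apply: le_trans le1; rewrite lerD2l lerN2.
apply: le_trans (markov_mean mu bD D0 a0) _.
rewrite ler_pdivrMr//; apply: le_trans mean_D _.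
rewrite /a le_eqVlt; apply/orP; left; apply/eqP; field.
by rewrite !lt0r_neq0.
Qed.

End degenerate_lower_bound.

(** * The law of the augmented sample *)

Section rectangles.
Context {R : realType} d1 d2 (T1 : measurableType d1) (T2 : measurableType d2).
Local Open Scope ereal_scope.

Lemma measure_unique_rect (m m' : {measure set (T1 * T2) -> \bar R}) :
  m setT < +oo ->
  (forall A B, measurable A -> measurable B -> m (A `*` B) = m' (A `*` B)) ->
  forall X, measurable X -> m X = m' X.
Proof.
move=> moo mm' X mX.
pose G : set (set (T1 * T2)) := [set A `*` B | A in measurable & B in measurable].
apply: (measure_unique G (fun=> setT)) => //.
- exact: measurable_prod_measurableType.
- move=> _ _ [A mA [B mB <-]] [A' mA' [B' mB' <-]].
  exists (A `&` A'); first exact: measurableI.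
  by exists (B `&` B'); [exact: measurableI|rewrite setXI].
- by move=> _; exists setT => //; exists setT => //; rewrite setXTT.
- by rewrite bigcup_const//; exists 0%N.
- by move=> _ [A mA [B mB <-]]; exact: mm'.
Qed.

(** Independence of an event [D] and a pair [W] of law [J] may be tested on
    rectangles, by uniqueness of the finite measure [A |-> Pr (W @^-1` A `&` D)]. *)
Lemma indep_event_rect d (T : measurableType d) (Pr : probability T R)
    (J : probability (T1 * T2)%type R) (W : T -> T1 * T2) (D : set T) :
  measurable_fun setT W -> measurable D ->
  (forall A B, measurable A -> measurable B ->
    Pr (W @^-1` (A `*` B) `&` D) = J (A `*` B) * Pr D) ->
  forall X, measurable X -> Pr (W @^-1` X `&` D) = J X * Pr D.
Proof.
move=> mW mD WD X mX.
have [m mE] : exists m : {measure set (T1 * T2) -> \bar R},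
    forall A, m A = Pr (W @^-1` A `&` D).
  by unshelve eexists (pushforward (mrestr Pr mD) W).
have PrD0 : (0 <= fine (Pr D))%R by exact: fine_ge0.
pose m' : {measure set (T1 * T2) -> \bar R} := mscale (NngNum PrD0) J.
have m'E A : m' A = J A * Pr D.
  by rewrite /m'/= /mscale/= fineK ?fin_num_measure// muleC.
rewrite -mE -m'E; apply: measure_unique_rect => //.
- by rewrite mE preimage_setT setTI; apply: le_lt_trans (ltry 1);
    exact: probability_le1.
- by move=> A B mA mB; rewrite mE m'E WD.
Qed.

End rectangles.

Section joint_law_of_sample.
Context {R : realType} {dx dy dz : nat}.
Context (P : probability (obs R dx dy dz) R).
Context (kappa : R.-pker (dz.-tuple R) ~> (dx.-tuple R)).
Context {dT : measure_display} {T : measurableType dT} {Pr : probability T R}.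
Context {n : nat} (V : 'I_n -> {RV Pr >-> obs R dx dy dz}).
Context (X' : 'I_n -> {RV Pr >-> dx.-tuple R}).
Hypothesis V_iid : iid_sample P V.
Hypothesis X'_resampled : resampled kappa V X'.
Local Notation J := (joint_law P kappa).

Let W i t := (V i t, X' i t).

(* The density against P of the first marginal of the joint law restricted to
   E `*` B. *)
Let weight (E : set (obs R dx dy dz)) (B : set (dx.-tuple R)) v : R :=
  \1_E v * fine (kappa v.2 B).

Let kappa_le1 v B : measurable B -> (kappa v B <= 1)%E.
Proof.
move=> mB; rewrite -(@prob_kernel _ _ _ _ _ kappa v).
by apply: le_measure => //; rewrite inE.
Qed.

Let kappa_fin v B : measurable B -> (fine (kappa v B))%:E = kappa v B.
Proof.
move=> mB; rewrite fineK// ge0_fin_numE//.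
by apply: le_lt_trans (ltry 1); exact: kappa_le1.
Qed.

Let bounded_weight E B : measurable E -> measurable B ->
  bounded_meas (weight E B).
Proof.
move=> mE mB; apply: bounded_measM.
  split; first exact: measurable_indic.
  by exists 1 => v; rewrite indicE ger0_norm// lern1 leq_b1.
split; last first.
  exists 1 => v; rewrite ger0_norm ?fine_ge0//.
  by rewrite -lee_fin kappa_fin// kappa_le1.
apply: measurableT_comp => //.
by apply: (measurableT_comp (measurable_kernel kappa B mB)).
Qed.

Let joint_lawX E B : measurable E -> measurable B ->
  J (E `*` B) = (\int[P]_v weight E B v)%:E.
Proof.
move=> mE mB; rewrite /Rintegral fineK; last first.
  exact/integrable_fin_num/bounded_meas_integrable/bounded_weight.
apply: eq_integral => v _ /=; rewrite /weight indicE.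
have [vE|vE] := boolP (v \in E).
  by rewrite in_xsectionX// mul1r kappa_fin.
by rewrite notin_xsectionX// measure0 mul0r.
Qed.

Let pair_law i j A : i != j -> measurable A ->
  Pr ((fun t => (V i t, V j t)) @^-1` A) = (P \x P)%E A.
Proof.
move=> ij mA.
have mVV : measurable_fun setT (fun t => (V i t, V j t)).
  exact: measurable_fun_pair.
pose VV : {RV Pr >-> _} := mfun_Sub (mem_set mVV).
rewrite -[LHS]/(distribution Pr VV A); apply/esym/product_measure_unique => //.
move=> E E' mE mE'.
have [law indep] := V_iid.
pose A_ k := if k == i then E else if k == j then E' else setT.
have mA_ k : measurable (A_ k) by rewrite /A_; case: eqP => // _; case: eqP.
have -> : (P E * P E')%E = (\prod_(k < n) Pr (V k @^-1` A_ k))%E.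
  rewrite (bigD1 i)//= (bigD1 j) 1?eq_sym//= big1 ?mule1.
    rewrite /A_ eqxx (negbTE (_ : j != i)) 1?eq_sym// eqxx.
    by rewrite !law.
  move=> k /andP[ki kj]; rewrite /A_ (negbTE ki) (negbTE kj).
  by rewrite preimage_setT probability_setT.
rewrite -indep//; congr (Pr _); apply/seteqP; split => t /=.
  move=> [tE tE'] k; rewrite /A_.
  by case: eqP => [->//|_]; case: eqP => [->//|_].
move=> h; have := h i; have := h j; rewrite /A_ eqxx.
by rewrite [j == i]eq_sym (negbTE ij) eqxx.
Qed.

(* Conditioning on the sample replaces the indicator of X'_i in B by
   kappa (Z_i) B; the two resulting functions of V_i and V_j are independent. *)
Let pair_rect i j E E' B B' : i != j ->
  measurable E -> measurable E' -> measurable B -> measurable B' ->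
  Pr (W i @^-1` (E `*` B) `&` W j @^-1` (E' `*` B')) =
  (J (E `*` B) * J (E' `*` B'))%E.
Proof.
move=> ij mE mE' mB mB'.
pose B_ k := if k == i then B else if k == j then B' else setT.
have mB_ k : measurable (B_ k) by rewrite /B_; case: eqP => // _; case: eqP.
pose A := [set u : n.-tuple (obs R dx dy dz) | E (tnth u i) /\ E' (tnth u j)].
have mA : measurable A.
  rewrite (_ : A = (@tnth n _ ^~ i) @^-1` E `&` (@tnth n _ ^~ j) @^-1` E')//.
  apply: measurableI.
    by rewrite -[X in measurable X]setTI; exact: measurable_tnth.
  by rewrite -[X in measurable X]setTI; exact: measurable_tnth.
transitivity (Pr [set w | A [tuple V i w | i < n] /\ forall i, B_ i (X' i w)]).
  congr (Pr _); apply/seteqP; split => t /=.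
    move=> [[tE tB] [tE' tB']]; rewrite /A/= !tnth_mktuple; split=> // k.
    by rewrite /B_; case: eqP => [->//|_]; case: eqP => [->//|_].
  rewrite /A/= !tnth_mktuple => -[[tE tE'] h]; have := h i; have := h j.
  by rewrite /B_ eqxx [j == i]eq_sym (negbTE ij) eqxx.
rewrite X'_resampled// integral_mkcond.
transitivity (\int[Pr]_t (weight E B (V i t) * weight E' B' (V j t))%:E)%E.
  apply: eq_integral => t _; rewrite patchE.
  have -> : (t \in [set w | A [tuple V i w | i < n]]) =
      (V i t \in E) && (V j t \in E').
    by apply/idP/andP; rewrite !inE /A/= !tnth_mktuple.
  rewrite (bigD1 i)//= (bigD1 j) 1?eq_sym//= big1 ?mule1; last first.
    move=> k /andP[ki kj]; rewrite /B_ (negbTE ki) (negbTE kj).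
    exact: prob_kernel.
  rewrite /B_ eqxx [j == i]eq_sym (negbTE ij) eqxx.
  rewrite -(kappa_fin (V i t).2 mB) -(kappa_fin (V j t).2 mB').
  rewrite /weight !indicE.
  by case: (V i t \in E); case: (V j t \in E'); rewrite /= ?mul1r ?mul0r ?mulr0.
have bw := bounded_weight mE mB; have bw' := bounded_weight mE' mB'.
have bww : bounded_meas (fun w : obs R dx dy dz * obs R dx dy dz =>
    weight E B w.1 * weight E' B' w.2).
  by apply: bounded_measM;
    [exact: bounded_meas_comp bw|exact: bounded_meas_comp bw'].
have mVV : measurable_fun setT (fun t => (V i t, V j t)).
  exact: measurable_fun_pair.
have eqR : \int[Pr]_t (weight E B (V i t) * weight E' B' (V j t)) =
    \int[P]_v weight E B v * \int[P]_v weight E' B' v.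
  rewrite (mean_law (f' := fun w => weight E B w.1 * weight E' B' w.2)
    (nu := (P \x P)%E) mVV)//; last by move=> X mX; exact: pair_law.
  rewrite -(mean_mean2 P P bww)/=.
  under eq_Rintegral do rewrite meanZ// mulrC.
  by rewrite meanZ// mulrC.
rewrite !joint_lawX// -EFinM -eqR /Rintegral fineK//.
apply/integrable_fin_num => //.
exact: (bounded_meas_integrable Pr (bounded_meas_comp mVV bww)).
Qed.

Let W_meas i : measurable_fun setT (W i).
Proof. exact: measurable_fun_pair. Qed.

Let measurable_W i A : measurable A -> measurable (W i @^-1` A).
Proof. by move=> mA; rewrite -[X in measurable X]setTI; exact: W_meas. Qed.

Let W_rect i j E B : i != j -> measurable E -> measurable B ->
  Pr (W i @^-1` (E `*` B)) = J (E `*` B).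
Proof.
move=> ij mE mB.
have := pair_rect ij mE measurableT mB measurableT.
by rewrite setXTT preimage_setT setIT probability_setT mule1.
Qed.

(* Rectangles are replaced by measurable sets in one coordinate at a time. *)
Let W_indep i j A A' : i != j -> measurable A -> measurable A' ->
  Pr (W i @^-1` A `&` W j @^-1` A') = (J A * J A')%E.
Proof.
move=> ij mA mA'; have ji : j != i by rewrite eq_sym.
have rect E' B' : measurable E' -> measurable B' ->
    Pr (W i @^-1` A `&` W j @^-1` (E' `*` B')) = (J A * J (E' `*` B'))%E.
  move=> mE' mB'; rewrite -(W_rect ji)//; apply: indep_event_rect => //.
    by apply: measurable_W; exact: measurableX.
  by move=> E B mE mB; rewrite pair_rect// (W_rect ji).
have WiE : Pr (W i @^-1` A) = J A.
  have := rect _ _ measurableT measurableT.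
  by rewrite setXTT preimage_setT setIT probability_setT mule1.
rewrite setIC muleC -WiE; apply: indep_event_rect => //.
  exact: measurable_W.
by move=> E B mE mB; rewrite setIC rect// muleC WiE.
Qed.

Lemma sample_law2 i j A : i != j -> measurable A ->
  Pr ((fun t => ((V i t, X' i t), (V j t, X' j t))) @^-1` A) = (J \x J)%E A.
Proof.
move=> ij mA.
have mWW : measurable_fun setT (fun t => (W i t, W j t)).
  exact: measurable_fun_pair.
pose WW : {RV Pr >-> _} := mfun_Sub (mem_set mWW).
rewrite -[LHS]/(distribution Pr WW A); apply/esym/product_measure_unique => //.
by move=> B B' mB mB'; exact: W_indep.
Qed.

(** A second index is used because the single law is read off the joint law of
    two augmented observations. *)
Lemma sample_law i A : (1 < n)%N -> measurable A ->
  Pr ((fun t => (V i t, X' i t)) @^-1` A) = J A.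
Proof.
move=> n1 mA.
have [j ij] : exists j : 'I_n, i != j.
  have [i0|i0] := eqVneq (val i) 0%N.
    by exists (Ordinal n1); apply/eqP => ij; rewrite ij in i0.
  by exists (Ordinal (ltnW n1)); apply: contra i0 => /eqP ->.
have := W_indep ij mA measurableT.
by rewrite preimage_setT setIT probability_setT mule1.
Qed.

End joint_law_of_sample.

(** * The population discrepancy and the rejection event *)

Section measurability.
Context {R : realType} {dx dy dz : nat} (sigma : R).
Local Notation obsT := (obs R dx dy dz).
Local Notation obsX := (obsT * dx.-tuple R)%type.

Lemma measurable_cat_tuple d (T : measurableType d) m n
    (f : T -> m.-tuple R) (g : T -> n.-tuple R) :
  measurable_fun setT f -> measurable_fun setT g ->
  measurable_fun setT (fun x => cat_tuple (f x) (g x)).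
Proof.
move=> /measurable_fun_tnthP mf /measurable_fun_tnthP mg.
apply/measurable_fun_tnthP => i; case: (split_ordP i) => j ->.
  by apply: eq_measurable_fun (mf j) => x _ /=; rewrite tnth_lshift.
by apply: eq_measurable_fun (mg j) => x _ /=; rewrite tnth_rshift.
Qed.

Lemma measurable_vec : measurable_fun setT (@vec R dx dy dz).
Proof.
apply: measurable_cat_tuple; last exact: measurable_snd.
apply: measurable_cat_tuple.
  exact: (measurableT_comp measurable_fst measurable_fst).
exact: (measurableT_comp measurable_snd measurable_fst).
Qed.

Lemma measurable_replX d (T : measurableType d) (f : T -> obsT)
    (g : T -> dx.-tuple R) :
  measurable_fun setT f -> measurable_fun setT g ->
  measurable_fun setT (fun t => replX (f t) (g t)).
Proof.
move=> mf mg; apply: measurable_fun_pair; last exact: measurableT_comp.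
apply: measurable_fun_pair => //; apply: measurableT_comp => //.
exact: measurableT_comp.
Qed.

Lemma bounded_meas_Kobs d (T : measurableType d) (f g : T -> obsT) :
  measurable_fun setT f -> measurable_fun setT g ->
  bounded_meas (fun t => Kobs sigma (f t) (g t)).
Proof.
move=> mf mg; split; last first.
  by exists 1 => t; have /andP[K0 K1] := Kobs_bounds sigma (f t) (g t);
    rewrite ger0_norm.
have mvf := measurableT_comp measurable_vec mf.
have mvg := measurableT_comp measurable_vec mg.
apply: measurableT_comp => //; apply: measurableT_comp => //.
apply: measurable_funM => //; apply: measurable_funM => //.
apply: measurable_sum => k; apply: measurable_funX.
apply: measurable_funB.
  by move/measurable_fun_tnthP : mvf => /(_ k).
by move/measurable_fun_tnthP : mvg => /(_ k).
Qed.

Let V (w : obsX) := w.1.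
Let V' (w : obsX) := replX w.1 w.2.
Let mV : measurable_fun setT V. Proof. exact: measurable_fst. Qed.
Let mV' : measurable_fun setT V'.
Proof. exact: measurable_replX. Qed.

Lemma bounded_meas_discr_ker d (T : measurableType d) (f g : T -> obsX) :
  measurable_fun setT f -> measurable_fun setT g ->
  bounded_meas (fun t => discr_ker sigma (f t) (g t)).
Proof.
move=> mf mg.
have mVf := measurableT_comp mV mf; have mVg := measurableT_comp mV mg.
have mVf' := measurableT_comp mV' mf; have mVg' := measurableT_comp mV' mg.
apply: bounded_measB; last exact: bounded_meas_Kobs.
apply: bounded_measB; last exact: bounded_meas_Kobs.
by apply: bounded_measD; exact: bounded_meas_Kobs.
Qed.

(** The two cross terms of the discrepancy kernel have equal means because the
    product of the joint law with itself is invariant under exchange. *)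
Lemma zetaE (P : probability obsT R)
    (kappa : R.-pker (dz.-tuple R) ~> (dx.-tuple R)) :
  zeta P kappa sigma =
  \int[(joint_law P kappa \x joint_law P kappa)%E]_w discr_ker sigma w.1 w.2.
Proof.
set J := joint_law P kappa.
pose JJ : probability (obsX * obsX)%type R := (J \x J)%E.
have bK (f g : obsX -> obsT) : measurable_fun setT f -> measurable_fun setT g ->
    bounded_meas (fun w : obsX * obsX => Kobs sigma (f w.1) (g w.2)).
  by move=> mf mg; apply: bounded_meas_Kobs; exact: measurableT_comp.
pose e (f g : obsX -> obsT) := \int[(J \x J)%E]_w Kobs sigma (f w.1) (g w.2).
have eE f g : measurable_fun setT f -> measurable_fun setT g ->
    ('E_(J \x J)[fun w => Kobs sigma (f w.1) (g w.2)] = (e f g)%:E)%E.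
  move=> mf mg; rewrite unlock /e /Rintegral fineK//.
  exact/integrable_fin_num/bounded_meas_integrable/bK.
have eC f g : measurable_fun setT f -> measurable_fun setT g -> e f g = e g f.
  move=> mf mg; pose sw (w : obsX * obsX) := (w.2, w.1).
  have msw : measurable_fun setT sw by exact: measurable_fun_pair.
  pose fg (u : obsX * obsX) := Kobs sigma (g u.1) (f u.2).
  transitivity (\int[(J \x J)%E]_w fg (sw w)).
    by apply: eq_Rintegral => w _; rewrite /fg/= KobsC.
  apply: (mean_law (mu := JJ) (nu := JJ) msw); last exact: bK.
  move=> A mA; pose SW : {RV JJ >-> _} := mfun_Sub (mem_set msw).
  rewrite -[LHS]/(distribution JJ SW A).
  apply/esym/product_measure_unique => // B C mB mC.
  rewrite /distribution /pushforward/=.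
  rewrite (_ : _ @^-1` _ = C `*` B); last first.
    by apply/seteqP; split => -[x y]/= [].
  by rewrite product_measure1E// muleC.
transitivity (fine ('E_(J \x J)[fun w => Kobs sigma (V w.1) (V w.2)]
    + 'E_(J \x J)[fun w => Kobs sigma (V' w.1) (V' w.2)]
    - 2%:E * 'E_(J \x J)[fun w => Kobs sigma (V w.1) (V' w.2)])%E) => //.
rewrite !eE//=.
have lin (f1 f2 f3 f4 : obsX * obsX -> R) :
    bounded_meas f1 -> bounded_meas f2 -> bounded_meas f3 -> bounded_meas f4 ->
    \int[JJ]_w (f1 w + f2 w - f3 w - f4 w) =
    \int[JJ]_w f1 w + \int[JJ]_w f2 w - \int[JJ]_w f3 w - \int[JJ]_w f4 w.
  move=> b1 b2 b3 b4; have b12 := bounded_measD b1 b2.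
  by rewrite (meanB JJ (bounded_measB b12 b3) b4) (meanB JJ b12 b3) meanD.
rewrite [RHS](lin _ _ _ _ (bK V V mV mV) (bK V' V' mV' mV')
  (bK V V' mV mV') (bK V' V mV' mV)) -/(e V V) -/(e V' V') -/(e V V') -/(e V' V).
rewrite (eC V' V mV' mV); move: (e V V) (e V' V') (e V V') => x y u; ring.
Qed.

Context {d : measure_display} {T : measurableType d} {n : nat}.
Context (X : 'I_n -> T -> obsT) (X' : 'I_n -> T -> dx.-tuple R).
Hypothesis mX : forall i, measurable_fun setT (X i).
Hypothesis mX' : forall i, measurable_fun setT (X' i).

Lemma measurable_rejection (alpha : R) : 0 < alpha < 1 ->
  measurable [set t | crit sigma alpha (fun i => X i t) (fun i => X' i t) <
                      stat sigma (fun i => X i t) (fun i => X' i t)].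
Proof.
move=> a01; under eq_set do rewrite crit_lt//.
have bk i j : bounded_meas
    (fun t => discr_ker sigma (X i t, X' i t) (X j t, X' j t)).
  by apply: bounded_meas_discr_ker; exact: measurable_fun_pair.
have ms : measurable_fun setT
    (fun t => stat sigma (fun i => X i t) (fun i => X' i t)).
  apply: measurable_funM => //; apply: (fun b => b.1).
  by apply: bounded_meas_sum => i; apply: bounded_meas_sum => j; exact: bk.
have mp p : measurable_fun setT
    (fun t => stat_swap sigma (fun i => X i t) (fun i => X' i t) p).
  under eq_fun do rewrite stat_swapE.
  apply: measurable_funM => //.
  have [] // : bounded_meas (fun t => chaos (fun i j =>
     discr_ker sigma (X i t, X' i t) (X j t, X' j t)) p).
  apply: bounded_meas_sum => i; apply: bounded_meas_sum => j.
  by apply: bounded_measM => //; exact: bounded_meas_cst.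
apply: measurable_ge_fun; apply: measurable_funM => //.
apply: measurable_sum => p.
rewrite (_ : (fun _ => _) = (fun t => if
   stat_swap sigma (fun i => X i t) (fun i => X' i t) p <
   stat sigma (fun i => X i t) (fun i => X' i t) then 1 else 0)); last first.
  by apply/funext => t; case: ifP.
by apply: measurable_fun_ifT => //; exact: measurable_fun_ltr.
Qed.

End measurability.

(** * Power of the test *)

(** The threshold [64 / alpha] serves both bounds: being larger than 64, it makes
    the diagonal terms negligible in [ustat_lower_bound], and it makes
    [s = zeta / 16] large enough for [crit_lt_of_large]. *)
Lemma test_power_lower_bound {R : realType} {dx dy dz : nat} (sigma alpha : R)
    (P : probability (obs R dx dy dz) R)
    (kappa : R.-pker (dz.-tuple R) ~> (dx.-tuple R))
    {dT : measure_display} {T : measurableType dT} {Pr : probability T R}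
    {n : nat} (V : 'I_n -> {RV Pr >-> obs R dx dy dz})
    (X' : 'I_n -> {RV Pr >-> dx.-tuple R}) :
  iid_sample P V -> resampled kappa V X' -> 0 < alpha < 1 -> (1 < n)%N ->
  64 / alpha <= n%:R * zeta P kappa sigma ->
  ((1 - 32 / (n%:R * zeta P kappa sigma))%:E <= test_power sigma alpha V X')%E.
Proof.
move=> iid res a01 n1 large; have /andP[a0 a1] := a01.
set J := joint_law P kappa; set z := zeta P kappa sigma in large *.
have n0 : (0 : R) < n%:R by rewrite ltr0n ltnW.
have a64 : 64 < 64 / alpha by rewrite ltr_pdivlMr//; lra.
have z0 : 0 < z by rewrite -(pmulr_rgt0 _ n0); lra.
pose W i t := (V i t, X' i t).
have mW i : measurable_fun setT (W i) by exact: measurable_fun_pair.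
pose U t := \sum_(i < n) \sum_(j < n | (i < j)%N) discr_ker sigma (W i t) (W j t).
have bU : bounded_meas U.
  by apply: bounded_meas_sum => i; apply: bounded_meas_sum => j;
    exact: bounded_meas_discr_ker.
have lb : 1 - 32 / (n%:R * z) <=
    fine (Pr [set t | z / 16 * 'C(n, 2)%:R <= U t]).
  have -> : (32 : R) = 16 * 2 by rewrite -natrM.
  rewrite /z (zetaE sigma P kappa) in z0 large *.
  apply: ustat_lower_bound => //.
  - by have [] := bounded_meas_discr_ker sigma (@measurable_fst _ _
      (obs R dx dy dz * dx.-tuple R)%type _) measurable_snd.
  - exact: discr_ker_le2.
  - exact: discr_kerC.
  - exact: psd_discr_ker.
  - by move=> i A mA; exact: (sample_law iid res).
  - by move=> i j A ij mA; exact: (sample_law2 iid res).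
  - lra.
have mE : measurable [set t | z / 16 * 'C(n, 2)%:R <= U t].
  by apply: measurable_ge_fun; case: bU.
apply: (@le_trans _ _ (Pr [set t | z / 16 * 'C(n, 2)%:R <= U t])).
  by rewrite -[leRHS]fineK ?lee_fin// fin_num_measure.
apply: le_measure; rewrite ?inE//.
  exact: measurable_rejection.
move=> t /= Ut; have N0 : (0 : R) < 'C(n, 2)%:R by rewrite ltr0n bin_gt0.
have s_ge : z / 16 <= stat sigma (fun i => V i t) (fun i => X' i t).
  by rewrite statE [leRHS]mulrC ler_pdivlMr.
apply: crit_lt_of_large => //; first by apply: lt_le_trans s_ge; rewrite divr_gt0.
apply: (@le_trans _ _ (alpha * (z / 16) ^+ 2 * 'C(n, 2)%:R)); last first.
  rewrite ler_pM2r// ler_pM2l// ler_sqr ?nnegrE//; first exact/ltW/divr_gt0.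
  by apply: le_trans s_ge; exact/ltW/divr_gt0.
have -> : 'C(n, 2)%:R = n%:R * (n%:R - 1) / 2 :> R.
  have -> : n%:R * (n%:R - 1) = 2 * 'C(n, 2)%:R :> R.
    by rewrite -natrM -mul_bin_diag bin1 natrM -subn1 natrB// ltnW.
  by field.
have n2 : (2 : R) <= n%:R by rewrite ler_nat.
have an : 64 <= alpha * (n%:R * z) by rewrite mulrC -ler_pdivrMr.
have nz : 64 <= n%:R * z by lra.
have sq : 64 * 64 <= alpha * (n%:R * z) * (n%:R * z) by apply: ler_pM; lra.
have half : 0 <= alpha * z ^+ 2 * (n%:R * (n%:R - 2)).
  by rewrite !mulr_ge0 ?exprn_ge0 ?subr_ge0// ltW.
lra.
Qed.

Theorem proposition3p3 (R : realType) (sigma : R) (sigma2_gt0 : 0 < sigma ^+ 2)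
    (dx dy dz : nat -> nat)
    (P : forall n, probability (obs R (dx n) (dy n) (dz n)) R)
    (kappa : forall n, R.-pker ((dz n).-tuple R) ~> ((dx n).-tuple R))
    (P_kappa : forall n, is_cond_law (P n) (kappa n))
    (dT : nat -> measure_display) (T : forall n, measurableType (dT n))
    (Pr : forall n, probability (T n) R)
    (V : forall n, 'I_n -> {RV (Pr n) >-> obs R (dx n) (dy n) (dz n)})
    (X' : forall n, 'I_n -> {RV (Pr n) >-> (dx n).-tuple R})
    (V_iid : forall n, iid_sample (P n) (V n))
    (X'_resampled : forall n, resampled (kappa n) (V n) (X' n))
    (zeta_large : n%:R * zeta (P n) (kappa n) sigma @[n --> \oo] --> +oo) :
  forall alpha : R, 0 < alpha < 1 ->
    test_power sigma alpha (V n) (X' n) @[n --> \oo] --> 1%E.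
Proof.
move=> alpha a01.
set z := fun n => n%:R * zeta (P n) (kappa n) sigma.
have zoo : z n @[n --> \oo] --> +oo by exact: zeta_large.
apply: (@squeeze_cvge _ _ _ _ (fun n => (1 - 32 * (z n)^-1)%:E) _ (cst 1%E)).
- near=> n; apply/andP; split.
    apply: test_power_lower_bound => //; near: n.
    by exists 2%N.
    by move/cvgryPge : zoo; exact.
  by apply: probability_le1; exact: measurable_rejection.
- apply: cvg_EFin; first by near=> n.
  rewrite -[X in _ --> X]subr0 -[X in _ - X](mulr0 32).
  apply: cvgB; first exact: cvg_cst.
  apply: cvgM; first exact: cvg_cst.
  apply/gtr0_cvgV0 => //.
  by move/cvgryPgt : zoo; exact.
- exact: cvg_cst.
Unshelve. all: by end_near. Qed.
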